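(* Let $(G,\Gamma)$ be a (discrete) Hecke pair with reduction $(G_r,\Gamma_r)$ and Schlichting completion $(\overline G,\overline\Gamma)$. The following are equivalent: (i) the pair $(G,\Gamma)$ has property (T); (ii) the pair $(G_r,\Gamma_r)$ has property (T); (iii) the pair $(\overline G,\overline\Gamma)$ has property (T); (iv) the group $\overline G$ has property (T). Here $G$ and $G_r$ are assumed to have the discrete topology and $\overline G$ is assumed to have its locally compact totally disconnected topology.
   Context: A (discrete) Hecke pair $(G,\Gamma)$ is a group $G$ with a subgroup $\Gamma$ such that every double coset $\Gamma g\Gamma$ contains finitely many left cosets. Put $R^\Gamma=\bigcap_{g\in G}g\Gamma g^{-1}$; the reduction of $(G,\Gamma)$ is $(G_r,\Gamma_r)=(G/R^\Gamma,\Gamma/R^\Gamma)$. The Schlichting completion $(\overline G,\overline\Gamma)$ is obtained by completing $G_r$ in the Hecke topology, i.e. the group topology in which the finite intersections of conjugates $g\Gamma_rg^{-1}$, $g\in G_r$, form a neighbourhood base at $e$; $\overline\Gamma$ is the closure of $\Gamma_r$. Then $\overline G$ is a totally disconnected locally compact group, $\overline\Gamma$ is a compact open subgroup, $G_r$ is dense in $\overline G$, and $G_r\cap\overline\Gamma=\Gamma_r$. Property (T) for pairs. Let $\mathscr G$ be a topological group, $\mathscr H$ a closed subgroup and $\pi:\mathscr G\to\mathcal U(\mathcal{K})$ a (continuous) unitary representation on a Hilbert space $\mathcal K$. Given $\varepsilon>0$ and a compact $\mathscr Q\subseteq\mathscr G/\mathscr H$, a unit vector $\xi$ is $(\varepsilon,\mathscr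 Q)$-invariant if $\xi$ is $\mathscr H$-invariant and $\|\pi(g)\xi-\xi\|<\varepsilon$ for all $g\in\mathscr{G}$ with $g\mathscr H\in\mathscr Q$. The representation $\pi$ has $\mathscr H$-invariant almost $\mathscr G$-invariant vectors if for every compact $\mathscr Q\subseteq\mathscr G/\mathscr H$ and every $\varepsilon>0$ there is an $(\varepsilon,\mathscr Q)$-invariant vector. The pair $(\mathscr G,\mathscr H)$ has property (T) if every unitary representation of $\mathscr G$ having $\mathscr H$-invariant almost $\mathscr G$-invariant vectors has a nonzero $\mathscr G$-invariant vector. The group $\mathscr G$ has property (T) (of Kazhdan) if $(\mathscr G,\{e\})$ has property (T) in this sense. *)

(* Defs.v *)
From HB Require Import structures.
From mathcomp Require Import all_boot all_order all_algebra.
From mathcomp Require Import generic_quotient sesquilinear complex.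
From mathcomp Require Import all_classical all_reals topology normedtype.

Set Implicit Arguments.
Unset Strict Implicit.
Unset Printing Implicit Defensive.

Import Order.TTheory GRing.Theory Num.Theory.
Import numFieldNormedType.Exports.

Local Open Scope classical_set_scope.
Local Open Scope quotient_scope.
Local Open Scope group_scope.

(* Lets a bundled subset [H] be applied: [H x]. *)
Identity Coercion set_funclass : set >-> Funclass.

Section Subgroups.
Context {G : groupType}.

Record subgroup := Subgroup {
  subgroup_set :> set G;
  subgroup_closed : group_closed [in subgroup_set] }.

Implicit Types (H : subgroup) (A : set G) (x y g : G).

Lemma subgroup_intro A : A 1 -> (forall x y, A x -> A y -> A (x / y)) ->
  group_closed [in A].
Proof.
move=> A1 AB; split; first exact: mem_set.
by move=> x y /set_mem Ax /set_mem Ay; apply: mem_set; exact: AB.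
Qed.

Lemma subgroup1 H : H 1.
Proof. by have [/set_mem] := subgroup_closed H. Qed.

Lemma subgroupV H x : H x -> H x^-1.
Proof.
move=> Hx; apply: set_mem.
by apply: (group_closedV (subgroup_closed H)); exact: mem_set.
Qed.

Lemma subgroupM H x y : H x -> H y -> H (x * y).
Proof.
move=> Hx Hy; apply: set_mem.
by apply: (group_closedM (subgroup_closed H)); exact: mem_set.
Qed.

Fact trivial_subgroup_closed : group_closed [in [set 1 : G]].
Proof. by apply: subgroup_intro => // x y -> ->; rewrite divgg. Qed.

Definition trivial_subgroup : subgroup := Subgroup trivial_subgroup_closed.

Definition lcoset A x : set G := [set x * a | a in A].

Definition dcoset A x : set G := [set a * x * b | a in A & b in A].

(* The conjugate g A g^-1; the library's [a ^ g] is g^-1 a g. *)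
Definition lconj A g : set G := [set g * a * g^-1 | a in A].

Lemma lconjE A g x : lconj A g x <-> A (g^-1 * x * g).
Proof.
split=> [[a Aa <-]|Ax]; last by exists (g^-1 * x * g); rewrite // !mulgA mulgV mul1g mulgK.
by rewrite !mulgA mulVg mul1g mulgVK.
Qed.

Lemma lconj1 H g : lconj H g 1.
Proof. by apply/lconjE; rewrite mulg1 mulVg; exact: subgroup1. Qed.

Lemma lconjV H g x : lconj H g x -> lconj H g x^-1.
Proof. by move=> /lconjE/subgroupV; rewrite !invgM invgK mulgA => /lconjE. Qed.

Lemma lconjM H g x y : lconj H g x -> lconj H g y -> lconj H g (x * y).
Proof.
move=> /lconjE Hx /lconjE Hy; apply/lconjE.
by have := subgroupM Hx Hy; rewrite !mulgA mulgK.
Qed.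

Definition hecke_pair H : Prop :=
  forall g, finite_set [set C | range (lcoset H) C /\ C `<=` dcoset H g].

Definition lcoset_rel H : rel G := fun x y => `[< H (x^-1 * y) >].

Lemma lcoset_rel_equiv H : equiv_class_of (lcoset_rel H).
Proof.
split=> [x|x y|y x z].
- by apply/asboolP; rewrite mulVg; exact: subgroup1.
- by apply: asbool_equiv_eq; split=> /subgroupV; rewrite invgM invgK.
- move=> /asboolP Hxy /asboolP Hyz; apply/asboolP.
  by have := subgroupM Hxy Hyz; rewrite mulgA mulgK.
Qed.

Canonical lcoset_equiv H := EquivRelPack (lcoset_rel_equiv H).

End Subgroups.
Arguments subgroup G : clear implicits.

Section QuotientGroup.
Context {G : groupType}.

Record normal_subgroup := NormalSubgroup {
  normal_subgroup_sub :> subgroup G;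
  normal_subgroup_conj :
    forall g, lconj normal_subgroup_sub g `<=` normal_subgroup_sub }.

Definition quotient_group (N : normal_subgroup) : Type :=
  {eq_quot (lcoset_equiv N)}.

Variable N : normal_subgroup.
Local Notation Q := (quotient_group N).

HB.instance Definition _ := Choice.on Q.
HB.instance Definition _ := EqQuotient.on Q.

Lemma quotient_groupE (x y : G) : (\pi_Q x = \pi_Q y) <-> N (x^-1 * y).
Proof.
split=> [/eqP|Nxy]; first by rewrite eqmodE => /asboolP.
by apply/eqP; rewrite eqmodE; apply/asboolP.
Qed.

Definition quotient_mul (a b : Q) : Q := \pi_Q (repr a * repr b).
Definition quotient_inv (a : Q) : Q := \pi_Q (repr a)^-1.

Lemma quotient_mulE x y : quotient_mul (\pi_Q x) (\pi_Q y) = \pi_Q (x * y).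
Proof.
rewrite /quotient_mul; case: piP => x' /quotient_groupE Nx.
case: piP => y' /quotient_groupE Ny; apply/esym/quotient_groupE.
have -> : (x * y)^-1 * (x' * y') = (y^-1 * (x^-1 * x') * y^-1^-1) * (y^-1 * y').
  by rewrite invgK invgM !mulgA mulgK.
apply: subgroupM => //; apply: (@normal_subgroup_conj N y^-1).
by exists (x^-1 * x').
Qed.

Lemma quotient_invE x : quotient_inv (\pi_Q x) = \pi_Q x^-1.
Proof.
rewrite /quotient_inv; case: piP => x' /quotient_groupE Nx.
apply/quotient_groupE; rewrite invgK.
have := @normal_subgroup_conj N x _ (ex_intro2 _ _ _ Nx erefl).
by rewrite !mulgA mulgV mul1g.
Qed.

Fact quotient_mulA : associative quotient_mul.
Proof.
elim/quotW=> x; elim/quotW=> y; elim/quotW=> z.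
by rewrite (quotient_mulE y) (quotient_mulE x y) !quotient_mulE mulgA.
Qed.

Fact quotient_mul1 : left_id (\pi_Q 1) quotient_mul.
Proof. by elim/quotW=> x; rewrite quotient_mulE mul1g. Qed.

Fact quotient_mulr1 : right_id (\pi_Q 1) quotient_mul.
Proof. by elim/quotW=> x; rewrite quotient_mulE mulg1. Qed.

Fact quotient_mulV : left_inverse (\pi_Q 1) quotient_inv quotient_mul.
Proof. by elim/quotW=> x; rewrite (quotient_invE x) quotient_mulE mulVg. Qed.

Fact quotient_mulrV : right_inverse (\pi_Q 1) quotient_inv quotient_mul.
Proof. by elim/quotW=> x; rewrite (quotient_invE x) quotient_mulE mulgV. Qed.

HB.instance Definition _ := isGroup.Build Q
  quotient_mulA quotient_mul1 quotient_mulr1 quotient_mulV quotient_mulrV.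

Definition quotient_map (x : G) : Q := \pi_Q x.

Fact quotient_map_morphism : monoid.monoid_morphism quotient_map.
Proof. by split=> // x y; rewrite /quotient_map -quotient_mulE. Qed.

HB.instance Definition _ :=
  isUMagmaMorphism.Build G Q quotient_map quotient_map_morphism.

End QuotientGroup.
Arguments normal_subgroup G : clear implicits.

Fact image_subgroup_closed (G G' : groupType) (f : UMagmaMorphism.type G G')
  (H : subgroup G) : group_closed [in f @` H].
Proof.
apply: subgroup_intro.
  by exists 1; [exact: subgroup1 | rewrite gmulf1].
move=> _ _ [x Hx <-] [y Hy <-]; exists (x / y); last by rewrite gmulfF.
by apply: subgroupM => //; exact: subgroupV.
Qed.

Definition image_subgroup (G G' : groupType) (f : UMagmaMorphism.type G G')
    (H : subgroup G) : subgroup G' :=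
  Subgroup (image_subgroup_closed f H).

Section Reduction.
Context {G : groupType} (H : subgroup G).

Definition hecke_core_set : set G := \bigcap_(g in [set: G]) lconj H g.

Fact hecke_core_closed : group_closed [in hecke_core_set].
Proof.
apply: subgroup_intro => [g _|x y Hx Hy g _]; first exact: lconj1.
by apply: lconjM; [exact: Hx | apply: lconjV; exact: Hy].
Qed.

Fact hecke_core_conj g : lconj hecke_core_set g `<=` hecke_core_set.
Proof.
move=> _ [y Hy <-] k _; have /lconjE := Hy (g^-1 * k) I.
by rewrite invgM invgK !mulgA => ?; apply/lconjE; rewrite !mulgA.
Qed.

Definition hecke_core : normal_subgroup G :=
  @NormalSubgroup G (Subgroup hecke_core_closed) hecke_core_conj.

Definition reduced_group : groupType := quotient_group hecke_core.

Definition reduced_subgroup : subgroup reduced_group :=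
  image_subgroup (@quotient_map G hecke_core) H.

End Reduction.

HB.mixin Record isTopologicalGroup G of Group G & Topological G := {
  mulg_continuous : continuous (fun x : G * G => x.1 * x.2);
  invg_continuous : continuous (fun x : G => x^-1) }.

#[short(type="topologicalGroupType")]
HB.structure Definition TopologicalGroup :=
  {G of Group G & Topological G & isTopologicalGroup G}.

Section DiscreteGroup.
Variable G : groupType.
Local Notation D := (discrete_topology G).

HB.instance Definition _ := Group.copy D G.

Fact discrete_mulg_continuous : continuous (fun x : D * D => x.1 * x.2).
Proof.
move=> [x y] A /= /nbhs_singleton Axy.
exists ([set x], [set y]); first by split; exact: discrete_set1.
by move=> [a b] [/= -> ->].
Qed.

Fact discrete_invg_continuous : continuous (fun x : D => x^-1).
Proof.
move=> x A /nbhs_singleton Ax.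
by apply: (filterS _ (discrete_set1 x)) => _ ->.
Qed.

HB.instance Definition _ := isTopologicalGroup.Build D
  discrete_mulg_continuous discrete_invg_continuous.

Definition discrete_subgroup (H : subgroup G) : subgroup D :=
  @Subgroup D (H : set G) (subgroup_closed H).

End DiscreteGroup.

Definition hecke_topology (G : groupType) (H : subgroup G) : Type := G.

Section HeckeTopology.
Variables (G : groupType) (H : subgroup G).
Local Notation T := (hecke_topology H).

HB.instance Definition _ := Group.copy T G.

Definition hecke_nbhs (x : T) : set_system T :=
  [set U | exists2 A : set G, finite_set A &
    lcoset (\bigcap_(g in A) lconj H g) x `<=` U].

HB.instance Definition _ := hasNbhs.Build T hecke_nbhs.

Fact hecke_nbhs_filter (x : T) : ProperFilter (nbhs x).
Proof.
apply: Build_ProperFilter_ex.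
  move=> U [A _ AU]; exists x; apply: AU; exists 1; last by rewrite mulg1.
  by move=> g _; exact: lconj1.
split.
- by exists set0.
- move=> U V [A fA AU] [B fB BV]; exists (A `|` B); first by rewrite finite_setU.
  move=> _ [k Hk <-]; split.
    by apply: AU; exists k => // g Ag; apply: Hk; left.
  by apply: BV; exists k => // g Bg; apply: Hk; right.
- by move=> U V UV [A fA AU]; exists A => //; exact: subset_trans UV.
Qed.

Fact hecke_nbhs_singleton (x : T) (U : set T) : nbhs x U -> U x.
Proof.
move=> [A _]; apply; exists 1; last by rewrite mulg1.
by move=> g _; exact: lconj1.
Qed.

Fact hecke_nbhs_nbhs (x : T) (U : set T) : nbhs x U -> nbhs x (nbhs^~ U).
Proof.
move=> [A fA AU]; exists A => // _ [k Hk <-]; exists A => // _ [l Hl <-].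
apply: AU; exists (k * l); last by rewrite mulgA.
by move=> g Ag; apply: lconjM; [exact: Hk | exact: Hl].
Qed.

HB.instance Definition _ := Nbhs_isNbhsTopological.Build T
  hecke_nbhs_filter hecke_nbhs_singleton hecke_nbhs_nbhs.

Fact hecke_mulg_continuous : continuous (fun x : T * T => x.1 * x.2).
Proof.
move=> [x y] U [A fA AU].
exists (lcoset (\bigcap_(g in [set y * a | a in A]) lconj H g) x,
        lcoset (\bigcap_(g in A) lconj H g) y).
  by split; [exists [set y * a | a in A] => //; exact: finite_image | exists A].
move=> [_ _] [/= [k Hk <-] [l Hl <-]].
apply: AU; exists (y^-1 * k * y * l); last by rewrite !mulgA mulgK.
move=> g Ag; apply: lconjM; last exact: Hl.
have /lconjE := Hk (y * g) (ex_intro2 _ _ _ Ag erefl).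
by rewrite invgM !mulgA => ?; apply/lconjE; rewrite !mulgA.
Qed.

Fact hecke_invg_continuous : continuous (fun x : T => x^-1).
Proof.
move=> x U [A fA AU].
exists [set x^-1 * a | a in A]; first exact: finite_image.
move=> _ [k Hk <-] /=; apply: AU; exists (x * k^-1 * x^-1).
  move=> g Ag; apply/lconjE.
  have /lconjV/lconjE := Hk (x^-1 * g) (ex_intro2 _ _ _ Ag erefl).
  by rewrite invgM invgK !mulgA.
by rewrite invgM !mulgA mulVg mul1g.
Qed.

HB.instance Definition _ := isTopologicalGroup.Build T
  hecke_mulg_continuous hecke_invg_continuous.

Definition hecke_subgroup : subgroup T :=
  @Subgroup T (H : set G) (subgroup_closed H).

End HeckeTopology.

Definition group_cauchy (G : topologicalGroupType) (F : set_system G) : Prop :=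
  forall U, nbhs (1 : G) U -> exists2 A, F A &
    forall x y, A x -> A y -> U (x^-1 * y) /\ U (x * y^-1).

Definition group_complete (G : topologicalGroupType) : Prop :=
  forall F : set_system G, ProperFilter F -> group_cauchy F ->
    exists x : G, F --> x.

(* The Hausdorff completion with respect to the two-sided uniformity. It is
   unique up to a unique isomorphism; [i] is injective when [G] is Hausdorff. *)
Record is_completion (G G' : topologicalGroupType)
    (i : UMagmaMorphism.type G G') : Prop := IsCompletion {
  completion_hausdorff : hausdorff_space G';
  completion_complete : group_complete G';
  completion_dense : dense (range i);
  completion_topology : forall (x : G) (U : set G),
    nbhs x U <-> exists2 V, nbhs (i x) V & i @^-1` V `<=` U }.

Fact closure_subgroup_closed (G : topologicalGroupType) (H : subgroup G) :
  group_closed [in closure H].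
Proof.
apply: subgroup_intro.
  by apply: subset_closure; exact: subgroup1.
move=> x y clx cly U Uxy.
have /= := @mulg_continuous G (x, y^-1) U Uxy.
move=> [[V W] /= [Vx Wy] VWU].
have [a [Ha Va]] := clx _ Vx.
have [b [Hb Wb]] := cly _ (@invg_continuous G y W Wy).
exists (a / b); split; first by apply: subgroupM => //; exact: subgroupV.
exact: (VWU (a, b^-1)).
Qed.

Definition closure_subgroup (G : topologicalGroupType) (H : subgroup G) :
    subgroup G :=
  Subgroup (closure_subgroup_closed H).

Definition lcosets (G : topologicalGroupType) (H : subgroup G) :
    topologicalType :=
  quotient_topology {eq_quot (lcoset_equiv H)}.

Definition to_lcoset (G : topologicalGroupType) (H : subgroup G) (g : G) :
  lcosets H := \pi_(lcosets H) g.

Lemma to_lcosetE (G : topologicalGroupType) (H : subgroup G) (x y : G) :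
  to_lcoset H x = to_lcoset H y <-> H (x^-1 * y).
Proof.
change (\pi_{eq_quot (lcoset_equiv H)} x = \pi y <-> H (x^-1 * y)).
split=> [/eqP|Hxy]; first by rewrite eqmodE => /asboolP.
by apply/eqP; rewrite eqmodE; apply/asboolP.
Qed.

(* The inner product is linear in its first argument. *)
HB.mixin Record isHilbert (R : realType) K of CompleteNormedModule R[i] K := {
  inner : {dot K for Num.Def.conjC}%R;
  inner_norm : forall x : K, (`|x| ^+ 2 = inner x x)%R }.

#[short(type="hilbertType")]
HB.structure Definition Hilbert (R : realType) :=
  {K of CompleteNormedModule R[i] K & isHilbert R K}.

(* Operators of a representation are invertible by [rep1] and [repM], so that
   preserving the inner product makes them unitary. Continuity is with respect
   to the strong operator topology. *)
Record unitary_rep (R : realType) (G : topologicalGroupType) (K : hilbertType R)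
    := UnitaryRep {
  rep :> G -> {linear K -> K};
  rep1 : forall x, rep 1 x = x;
  repM : forall g h x, rep (g * h) x = rep g (rep h x);
  rep_inner : forall g x y, inner (rep g x) (rep g y) = inner x y;
  rep_continuous : forall x, continuous (fun g => rep g x) }.

Section PropertyT.
Context {R : realType} {G : topologicalGroupType}.

Section Invariance.
Context {K : hilbertType R} (pi : unitary_rep G K) (H : subgroup G).

Definition invariant (A : set G) (x : K) : Prop := forall g, A g -> pi g x = x.

Definition eps_invariant (eps : R) (Q : set (lcosets H)) (x : K) : Prop :=
  [/\ `|x|%R = 1%R, invariant H x &
    forall g, Q (to_lcoset H g) -> (`|pi g x - x| < eps%:C%C)%R].

Definition has_almost_invariant : Prop :=
  forall (Q : set (lcosets H)) (eps : R), compact Q -> (0 < eps)%R ->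
    exists x, eps_invariant eps Q x.

End Invariance.
End PropertyT.

Definition property_T (R : realType) (G : topologicalGroupType)
    (H : subgroup G) : Prop :=
  forall (K : hilbertType R) (pi : unitary_rep G K),
    has_almost_invariant pi H -> exists2 x : K, x != 0%R & invariant pi setT x.

Definition group_property_T (R : realType) (G : topologicalGroupType) : Prop :=
  property_T R (@trivial_subgroup G).

Definition schlichting_completion (G : groupType) (H : subgroup G)
    (G' : topologicalGroupType)
    (i : UMagmaMorphism.type (hecke_topology (reduced_subgroup H)) G') : Prop :=
  is_completion i.

Definition schlichting_subgroup (G : groupType) (H : subgroup G)
    (G' : topologicalGroupType)
    (i : UMagmaMorphism.type (hecke_topology (reduced_subgroup H)) G') :
    subgroup G' :=
  closure_subgroup (image_subgroup i (hecke_subgroup (reduced_subgroup H))).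

(* Existence of the completion of a group in its Hecke topology, realized by
   the permutations of G/H that agree on finite sets, together with their
   inverses, with translations by elements of G. *)
Section HeckeCompletion.
Context {G : groupType} (H : subgroup G).
Local Notation X := {eq_quot (lcoset_equiv H)}.
Local Notation T := (hecke_topology H).

Definition coset_act (g : G) (a : X) : X := \pi_X (g * repr a).

Lemma coset_actE g x : coset_act g (\pi_X x) = \pi_X (g * x).
Proof.
rewrite /coset_act; case: piP => x' /eqP; rewrite eqmodE => /asboolP Hx.
by apply/esym/eqP; rewrite eqmodE; apply/asboolP; rewrite invgM !mulgA mulgVK.
Qed.

Lemma coset_act1 a : coset_act 1 a = a.
Proof. by elim/quotW: a => x; rewrite coset_actE mul1g. Qed.

Lemma coset_actM g h a : coset_act (g * h) a = coset_act g (coset_act h a).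
Proof. by elim/quotW: a => x; rewrite !(coset_actE _ x) coset_actE mulgA. Qed.

Lemma coset_act_fix k g :
  lconj H g k <-> coset_act k (\pi_X g) = \pi_X g.
Proof.
rewrite coset_actE; split=> [/lconjE Hk|/esym/eqP].
  by apply/esym/eqP; rewrite eqmodE; apply/asboolP; rewrite mulgA.
by rewrite eqmodE => /asboolP Hk; apply/lconjE; rewrite -mulgA.
Qed.

Record coset_perm := CosetPerm {
  cperm : X -> X;
  cpermV : X -> X;
  cpermK : cancel cperm cpermV;
  cpermVK : cancel cpermV cperm;
  cperm_approx : forall s : set X, finite_set s -> exists g, forall a, s a ->
    coset_act g a = cperm a /\ coset_act g^-1 a = cpermV a }.

Lemma coset_perm_eq p q : cperm p =1 cperm q -> cpermV p =1 cpermV q -> p = q.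
Proof.
case: p q => [p p' ? ? ?] [q q' ? ? ?] /= /funext pq /funext pq'.
by subst q q'; congr CosetPerm; exact: Prop_irrelevance.
Qed.

HB.instance Definition _ := gen_eqMixin coset_perm.
HB.instance Definition _ := gen_choiceMixin coset_perm.

Definition coset_translation (g : T) : coset_perm.
Proof.
refine (@CosetPerm (coset_act g) (coset_act (g : G)^-1) _ _ _).
- by move=> a; rewrite -coset_actM mulVg coset_act1.
- by move=> a; rewrite -coset_actM mulgV coset_act1.
- by move=> s _; exists g.
Defined.

Definition coset_perm_inv (p : coset_perm) : coset_perm.
Proof.
refine (@CosetPerm (cpermV p) (cperm p) (@cpermVK p) (@cpermK p) _).
move=> s fs; have [g gs] := cperm_approx p fs.
by exists g^-1 => a /gs; rewrite invgK => -[].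
Defined.

Definition coset_perm_mul (p q : coset_perm) : coset_perm.
Proof.
refine (@CosetPerm (cperm p \o cperm q) (cpermV q \o cpermV p) _ _ _).
- by move=> a /=; rewrite !cpermK.
- by move=> a /=; rewrite !cpermVK.
- move=> s fs.
  have fs2 : finite_set (s `|` (cperm q @` s `|` cpermV p @` s)).
    by rewrite !finite_setU; split=> //; split; exact: finite_image.
  have [g gs] := cperm_approx p fs2; have [h hs] := cperm_approx q fs2.
  exists (g * h) => a sa /=; rewrite invgM !coset_actM; split.
    by rewrite (hs a _).1; [rewrite (gs _ _).1//; right; left; exists a | left].
  by rewrite (gs a _).2; [rewrite (hs _ _).2//; right; right; exists a | left].
Defined.

Local Notation P := coset_perm.

Fact coset_perm_mulA : associative coset_perm_mul.
Proof. by move=> p q r; exact: coset_perm_eq. Qed.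

Fact coset_perm_mul1 : left_id (coset_translation 1) coset_perm_mul.
Proof.
by move=> p; apply: coset_perm_eq => a /=; rewrite ?invg1 coset_act1.
Qed.

Fact coset_perm_mulr1 : right_id (coset_translation 1) coset_perm_mul.
Proof.
by move=> p; apply: coset_perm_eq => a /=; rewrite ?invg1 coset_act1.
Qed.

Fact coset_perm_mulV :
  left_inverse (coset_translation 1) coset_perm_inv coset_perm_mul.
Proof.
move=> p; apply: coset_perm_eq => a /=; rewrite ?invg1 coset_act1; exact: cpermK.
Qed.

Fact coset_perm_mulrV :
  right_inverse (coset_translation 1) coset_perm_inv coset_perm_mul.
Proof.
move=> p; apply: coset_perm_eq => a /=; rewrite ?invg1 coset_act1; exact: cpermVK.
Qed.

HB.instance Definition _ := isGroup.Build P coset_perm_mulA coset_perm_mul1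
  coset_perm_mulr1 coset_perm_mulV coset_perm_mulrV.

Definition coset_agree (s : set X) (p : P) : set P :=
  [set q | forall a, s a -> cperm q a = cperm p a /\ cpermV q a = cpermV p a].

Definition coset_perm_nbhs (p : P) : set_system P :=
  [set U | exists2 s, finite_set s & coset_agree s p `<=` U].

HB.instance Definition _ := hasNbhs.Build P coset_perm_nbhs.

Fact coset_perm_nbhs_filter (p : P) : ProperFilter (nbhs p).
Proof.
apply: Build_ProperFilter_ex.
  by move=> U [s _ sU]; exists p; exact: sU.
split.
- by exists set0.
- move=> U V [s fs sU] [t ft tV]; exists (s `|` t); first by rewrite finite_setU.
  move=> q qst; split; [apply: sU|apply: tV] => a ?; apply: qst;
    by [left|right].
- by move=> U V UV [s fs sU]; exists s => //; exact: subset_trans UV.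
Qed.

Fact coset_perm_nbhs_singleton (p : P) (U : set P) : nbhs p U -> U p.
Proof. by move=> [s _]; exact. Qed.

Fact coset_perm_nbhs_nbhs (p : P) (U : set P) : nbhs p U -> nbhs p (nbhs^~ U).
Proof.
move=> [s fs sU]; exists s => // q qs; exists s => // r rs; apply: sU => a sa.
by have [-> ->] := rs a sa; exact: qs.
Qed.

HB.instance Definition _ := Nbhs_isNbhsTopological.Build P
  coset_perm_nbhs_filter coset_perm_nbhs_singleton coset_perm_nbhs_nbhs.

Fact coset_perm_mul_continuous : continuous (fun x : P * P => x.1 * x.2).
Proof.
move=> [p q] U [s fs sU].
have fs2 : finite_set (s `|` (cperm q @` s `|` cpermV p @` s)).
  by rewrite !finite_setU; split=> //; split; exact: finite_image.
set s2 := _ `|` _ in fs2.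
exists (coset_agree s2 p, coset_agree s2 q); first by split; exists s2.
move=> [c d] [/= cp dq]; apply: sU => a sa /=; split.
  by rewrite (dq a _).1; [rewrite (cp _ _).1//; right; left; exists a | left].
by rewrite (cp a _).2; [rewrite (dq _ _).2//; right; right; exists a | left].
Qed.

Fact coset_perm_inv_continuous : continuous (fun x : P => x^-1).
Proof.
move=> p U [s fs sU]; exists s => // q qs; apply: sU => a /qs[].
by split.
Qed.

HB.instance Definition _ := isTopologicalGroup.Build P
  coset_perm_mul_continuous coset_perm_inv_continuous.

Fact coset_translation_morphism : monoid.monoid_morphism coset_translation.
Proof.
split=> // g h; apply: coset_perm_eq => a /=; first exact: coset_actM.
by rewrite (_ : (_ * _)^-1 = (h : G)^-1 * (g : G)^-1) ?coset_actM//; exact: invgM.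
Qed.

HB.instance Definition _ := isUMagmaMorphism.Build T P coset_translation
  coset_translation_morphism.

Lemma coset_perm_hausdorff : hausdorff_space P.
Proof.
move=> p q clpq.
have agree a : cperm p a = cperm q a /\ cpermV p a = cpermV q a.
  have N r : nbhs r (coset_agree [set a] r) by exists [set a].
  have [c [/(_ a erefl)[<- <-] /(_ a erefl)[<- <-]]] := clpq _ _ (N p) (N q).
  by [].
by apply: coset_perm_eq => a; have [] := agree a.
Qed.

Lemma coset_perm_complete : group_complete P.
Proof.
move=> F FF Fcauchy.
have ev a : exists v : X * X, F [set c | cperm c a = v.1 /\ cpermV c a = v.2].
  have N : nbhs (1 : P) (coset_agree [set a] 1) by exists [set a].
  have [A FA AU] := Fcauchy _ N; have [c Ac] := filter_ex FA.
  exists (cperm c a, cpermV c a); apply: filterS FA => d Ad /=.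
  have [/(_ a erefl)[/= + _] _] := AU _ _ Ac Ad.
  have [_ /(_ a erefl)[/= + _]] := AU _ _ Ac Ad.
  rewrite coset_act1 => /(canRL (@cpermK c)) -> /(canRL (@cpermVK c)) ->.
  by [].
have [v Fv] := choice ev.
have Fs s : finite_set s ->
    F [set c | forall a, s a -> cperm c a = (v a).1 /\ cpermV c a = (v a).2].
  move=> /finite_fsetP[S ->]; apply: filterS (@filter_bigI _ _ S _ F FF (fun a _ => Fv a)).
  by move=> c cS a aS; exact: cS.
have vK : cancel (fun a => (v a).1) (fun a => (v a).2).
  move=> a; have [c [[ca _] [_ cva]]] := filter_ex (filterI (Fv a) (Fv (v a).1)).
  by rewrite -cva -ca cpermK.
have vK' : cancel (fun a => (v a).2) (fun a => (v a).1).
  move=> a; have [c [[_ ca] [cva _]]] := filter_ex (filterI (Fv a) (Fv (v a).2)).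
  by rewrite -cva -ca cpermVK.
have vapprox s : finite_set s -> exists g, forall a, s a ->
    coset_act g a = (v a).1 /\ coset_act g^-1 a = (v a).2.
  move=> fs; have [c cs] := filter_ex (Fs s fs).
  have [g gs] := cperm_approx c fs; exists g => a sa.
  by have [<- <-] := cs a sa; exact: gs.
exists (CosetPerm vK vK' vapprox) => U [s fs sU].
by apply: filterS (Fs s fs) => c cs; exact: sU.
Qed.

Theorem hecke_completion :
  is_completion (coset_translation : UMagmaMorphism.type T P).
Proof.
split; [exact: coset_perm_hausdorff|exact: coset_perm_complete| |].
- move=> O [p Op]; rewrite openE => /(_ p Op)[s fs sO].
  have [g gs] := cperm_approx p fs.
  by exists (coset_translation g); split; [exact: sO | exists g].
- move=> x U; split=> [[A fA AU]|[V [s fs sV] VU]].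
    exists (coset_agree (\pi_X @` A) (coset_translation x)).
      by exists (\pi_X @` A) => //; exact: finite_image.
    move=> y yx; apply: AU; exists ((x : G)^-1 * y); last by rewrite mulgA mulgV mul1g.
    move=> g Ag; apply/coset_act_fix; rewrite coset_actM.
    have [/= -> _] := yx _ (ex_intro2 _ _ g Ag erefl).
    by rewrite -coset_actM mulVg coset_act1.
  exists (repr @` (s `|` coset_act (x : G)^-1 @` s)).
    by apply: finite_image; rewrite finite_setU; split=> //; exact: finite_image.
  move=> _ [k Hk <-]; apply: VU; apply: sV => a sa /=; split.
    rewrite coset_actM; congr coset_act; rewrite -[a]reprK; apply/coset_act_fix.
    by apply: Hk; exists a => //; left.
  rewrite (_ : (_ * _)^-1 = k^-1 * (x : G)^-1); last exact: invgM.
  rewrite coset_actM; set b := coset_act _ a.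
  rewrite -[b]reprK; apply/coset_act_fix; apply: lconjV.
  by apply: Hk; exists b => //; right; exists a.
Qed.

End HeckeCompletion.

(* Main.v *)
From HB Require Import structures.
From mathcomp Require Import all_boot all_order all_algebra.
From mathcomp Require Import finmap generic_quotient sesquilinear complex.
From mathcomp Require Import all_classical all_reals topology normedtype.
From mathcomp Require Import ring lra.
Require Import Defs.

(** The four properties are proved equivalent in a cycle. Write [j] for the
homomorphism from [G] to the completion [Gbar] and [Gammabar] for the closure
of [j Gamma], an open subgroup.

From (i) to (ii) to (iii): property (T) of a pair passes along a continuous
homomorphism with dense range that maps the smaller group into the smaller
group. Pull a representation back: it keeps its almost invariant vectors, since
compact sets of cosets have compact images, and a vector fixed by a dense
subgroup is fixed by the whole group ([property_T_dense_image]).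

From (iii) to (iv): the Hecke condition says that [Gamma] meets each finite
intersection of its conjugates in a subgroup of finite index
([hecke_finite_index]), so that [j Gamma] is totally bounded and [Gammabar] is
compact ([totally_bounded_closure_compact]). A vector [x] moved little by
[Gammabar] is then replaced by the vector of least norm in the closed midpoint
convex hull of its [Gammabar]-orbit. That vector is unique, hence
[Gammabar]-invariant, and it is close to [x] ([fixed_vector_near]). Thus almost
invariant vectors of [Gbar] yield [Gammabar]-invariant ones
([property_T_compact_open]), without recourse to Haar measure.

From (iv) to (i): first, (iv) implies (iii), as compact sets of [Gbar] have
compact images in the coset space. Given a representation of [G], consider the
vectors whose orbit map is continuous for the topology that [j] induces on [G].
They form a closed invariant subspace on which the representation extends to
[Gbar] by passing to limits ([extension]). Since [Gamma] is open in the induced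
topology, this subspace contains all [Gamma]-invariant vectors; these become
[Gammabar]-invariant, and as [Gammabar] is open and [j] has dense range, the
almost invariant vectors remain almost invariant. A vector fixed by [Gbar] is
fixed by [G] ([property_T_completion]). The vectors of this subspace are fixed
by the normal core of [Gamma], which accounts for the reduction. *)

Set Implicit Arguments.
Unset Strict Implicit.
Unset Printing Implicit Defensive.

Import Order.TTheory GRing.Theory Num.Theory.
Import numFieldNormedType.Exports.

Local Open Scope classical_set_scope.
Local Open Scope quotient_scope.
Local Open Scope ring_scope.

(** * Closed subspaces of Hilbert spaces *)

Section ClosedSubspace.
Context {R : realType} {K : hilbertType R}.

Record closed_subspace := ClosedSubspace {
  subspace_set :> set K;
  subspace_submod : submod_closed [in subspace_set];
  subspace_closed : closed subspace_set }.

Variable V : closed_subspace.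

(** Closure properties are declared on a head constant, which canonical
structure inference can recognize. *)
Definition subspace_pred : {pred K} := [in subspace_set V].

Definition subspace_type : Type := {x : K | subspace_pred x}.
Local Notation T := subspace_type.

HB.instance Definition _ := GRing.isSubmodClosed.Build R[i] K subspace_pred
  (subspace_submod V).
HB.instance Definition _ := SubChoice.on T.
HB.instance Definition _ := [SubChoice_isSubLmodule of T by <:].

Definition subspace_norm (x : T) : R[i] := `|val x|.

Fact subspace_normD (x y : T) :
  subspace_norm (x + y) <= subspace_norm x + subspace_norm y.
Proof. by rewrite /subspace_norm raddfD; exact: ler_normD. Qed.

Fact subspace_normZ (l : R[i]) (x : T) :
  subspace_norm (l *: x) = `|l| * subspace_norm x.
Proof. by rewrite /subspace_norm linearZ normrZ. Qed.

Fact subspace_norm_eq0 (x : T) : subspace_norm x = 0 -> x = 0.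
Proof. by move=> /normr0_eq0 x0; apply: val_inj; rewrite raddf0. Qed.

HB.instance Definition _ := Lmodule_isNormed.Build R[i] T
  subspace_normD subspace_normZ subspace_norm_eq0.

Lemma subspace_normE (x : T) : `|x| = `|val x|.
Proof. by []. Qed.

Fact subspace_complete (F : set_system T) : ProperFilter F -> cauchy F -> cvg F.
Proof.
move=> FF /(cauchyP (R := R[i])) Fc.
have: cvg (val @ F).
  apply: cauchy_cvg; apply/(cauchyP (R := R[i])) => e e0.
  have [x Fx] := Fc e e0; exists (val x).
  suff: ball x e `<=` val @^-1` ball (val x) e by move=> /filterS; exact.
  by move=> y; rewrite /preimage/= -!ball_normE /ball_/= subspace_normE raddfB.
move=> /cvg_ex[l Fl].
have Vl : l \in subspace_set V.
  apply/mem_set; have cV := @subspace_closed V.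
  refine (@closed_cvg T K F FF val (subspace_set V) cV _ l Fl).
  by apply: nearW => x; exact/set_mem/(valP x).
apply/cvg_ex; exists (Sub l Vl : T).
apply/cvgrPdist_lt => e e0; move/cvgrPdist_lt: Fl => /(_ e e0).
by apply: filterS => x; rewrite subspace_normE raddfB.
Qed.

HB.instance Definition _ := Uniform_isComplete.Build T subspace_complete.

Definition subspace_inner (x y : T) : R[i] := inner (val x) (val y).

Fact subspace_inner_bilinear :
  bilinear_for *%R (Num.Def.conjC \; *%R) subspace_inner.
Proof.
split=> [y a x z|x a y z]; rewrite /subspace_inner.
  have -> : val (a *: x + z) = a *: val x + val z by rewrite linearP.
  by rewrite linearDl /= linearZl_LR.
have -> : val (a *: y + z) = a *: val y + val z by rewrite linearP.
by rewrite linearD /= linearZr_LR.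
Qed.

HB.instance Definition _ := bilinear_isBilinear.Build R[i] T T R[i]
  *%R (Num.Def.conjC \; *%R) subspace_inner subspace_inner_bilinear.

Fact subspace_inner_hermitian (x y : T) :
  subspace_inner x y = (-1) ^+ false * Num.Def.conjC (subspace_inner y x).
Proof. exact: hermitian_subproof. Qed.

HB.instance Definition _ := isHermitianSesquilinear.Build R[i] T false
  Num.Def.conjC subspace_inner subspace_inner_hermitian.

Fact subspace_inner_gt0 (x : T) : x != 0 -> 0 < subspace_inner x x.
Proof.
move=> x0; apply: neq0_dnorm_gt0; apply: contra x0 => /eqP x0.
by apply/eqP/val_inj; rewrite raddf0.
Qed.

HB.instance Definition _ := isDotProduct.Build R[i] T subspace_inner
  subspace_inner_gt0.

Fact subspace_inner_norm (x : T) : `|x| ^+ 2 = subspace_inner x x.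
Proof. exact: inner_norm. Qed.

HB.instance Definition _ := isHilbert.Build R T subspace_inner_norm.

End ClosedSubspace.

(** * Vectors of least norm *)

Section Hilbert.
Context {R : realType} {K : hilbertType R}.
Implicit Types x y : K.

Lemma innerDl x y z : inner (x + y) z = inner x z + inner y z.
Proof. exact: linearDl. Qed.

Lemma innerDr x y z : inner x (y + z) = inner x y + inner x z.
Proof. exact: linearDr. Qed.

Lemma innerZl a x y : inner (a *: x) y = a * inner x y.
Proof. exact: linearZl_LR. Qed.

Lemma innerZr a x y : inner x (a *: y) = a^* * inner x y.
Proof. exact: linearZr_LR. Qed.

Lemma parallelogram x y :
  `|x + y| ^+ 2 + `|x - y| ^+ 2 = (`|x| ^+ 2 + `|y| ^+ 2) *+ 2.
Proof.
rewrite -scaleN1r !inner_norm !(innerDl, innerDr, innerZl, innerZr) rmorphN1.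
by ring.
Qed.

Lemma polarization x y : 2 * inner x y =
  (`|x + y| ^+ 2 - `|x| ^+ 2 - `|y| ^+ 2)
   - 'i * (`|'i *: x + y| ^+ 2 - `|'i *: x| ^+ 2 - `|y| ^+ 2).
Proof.
rewrite !inner_norm !(innerDl, innerDr, innerZl, innerZr) conjCi.
have i2 : 'i * 'i = -1 :> R[i] by rewrite -expr2 sqrCi.
by ring: i2.
Qed.

(** By polarization, the norm determines the inner product. *)
Lemma isometry_inner (f : {linear K -> K}) : (forall x, `|f x| = `|x|) ->
  forall x y, inner (f x) (f y) = inner x y.
Proof.
move=> fN x y; have n2 : 2 != 0 :> R[i] by rewrite pnatr_eq0.
by apply: (mulfI n2); rewrite !polarization -!linearZ -!linearD !fN.
Qed.

Lemma isometry_norm (f : {linear K -> K}) :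
  (forall x y, inner (f x) (f y) = inner x y) -> forall x, `|f x| = `|x|.
Proof.
move=> fI x; apply/eqP; rewrite -(@eqrXn2 _ 2)//; apply/eqP.
by rewrite !inner_norm fI.
Qed.

Lemma isometry_continuous (f : {linear K -> K}) :
  (forall x, `|f x| = `|x|) -> continuous f.
Proof.
move=> fN x; apply/cvgrPdist_lt => e e0; near=> y.
rewrite -linearB fN.
by near: y; exact: cvgr_dist_lt.
Unshelve. all: by end_near. Qed.


(** The norm takes values in the partially ordered field [R[i]]; its real part
is used wherever total order, infima or [lra] are needed. *)
Definition real_norm x : R := complex.Re `|x|.

Lemma real_normE x : (real_norm x)%:C%C = `|x|.
Proof. by rewrite RRe_real// ger0_real. Qed.

Lemma real_norm_ge0 x : 0 <= real_norm x.
Proof. by rewrite -lecR real_normE; exact: normr_ge0. Qed.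

Lemma ler_real_norm x y : (real_norm x <= real_norm y) = (`|x| <= `|y|).
Proof. by rewrite -lecR !real_normE. Qed.

Lemma ler_real_distD z x y :
  real_norm (x - y) <= real_norm (x - z) + real_norm (z - y).
Proof. by rewrite -lecR rmorphD/= !real_normE; exact: ler_distD. Qed.

Lemma real_distC x y : real_norm (x - y) = real_norm (y - x).
Proof. by rewrite /real_norm distrC. Qed.

Lemma real_parallelogram x y : real_norm (x + y) ^+ 2 + real_norm (x - y) ^+ 2
  = (real_norm x ^+ 2 + real_norm y ^+ 2) *+ 2.
Proof.
apply: complexI; rewrite rmorphD rmorphMn/= rmorphD !rmorphXn/= !real_normE.
exact: parallelogram.
Qed.

(** Convexity restricted to midpoints, to which the parallelogram law
applies. *)
Definition midconvex (D : set K) : Prop :=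
  forall x y, D x -> D y -> D (2^-1 *: (x + y)).

Lemma real_norm_mid x y : real_norm (2^-1 *: (x + y)) = real_norm (x + y) / 2.
Proof.
apply: complexI; rewrite real_normE normrZ mulrC rmorphM/= real_normE.
by rewrite ger0_norm ?invr_ge0 ?ler0n// fmorphV rmorph_nat.
Qed.

(** Uniform convexity: the midpoint of [x] and [y] has norm at least [m], so
the parallelogram law bounds the square of the norm of [x - y] by
[4 (m + d)^2 - 4 m^2]. *)
Lemma midconvex_dist (D : set K) (m d : R) x y : midconvex D ->
  0 <= m -> 0 <= d <= 1 -> (forall z, D z -> m <= real_norm z) ->
  D x -> D y -> real_norm x <= m + d -> real_norm y <= m + d ->
  real_norm (x - y) ^+ 2 <= (8 * m + 4) * d.
Proof.
move=> mD m0 /andP[d0 d1] Dm Dx Dy xm ym.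
have := Dm _ (mD _ _ Dx Dy); rewrite real_norm_mid => xym.
have := real_parallelogram x y.
have := real_norm_ge0 x; have := real_norm_ge0 y.
have := real_norm_ge0 (x - y).
set a := real_norm x in xm *; set b := real_norm y in ym *.
set s := real_norm (x + y) in xym *; set t := real_norm (x - y) => t0 b0 a0.
rewrite mulr2n => par.
have a2 : a ^+ 2 <= (m + d) ^+ 2 by rewrite lerXn2r ?nnegrE ?addr_ge0.
have b2 : b ^+ 2 <= (m + d) ^+ 2 by rewrite lerXn2r ?nnegrE ?addr_ge0.
have s2 : (2 * m) ^+ 2 <= s ^+ 2.
  rewrite lerXn2r ?nnegrE ?mulr_ge0//; lra.
have dd : d ^+ 2 <= d by rewrite expr2 ler_piMl.
nra.
Qed.

Lemma min_norm_unique (D : set K) x y : midconvex D -> D x -> D y ->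
  (forall z, D z -> `|x| <= `|z|) -> `|y| = `|x| -> y = x.
Proof.
move=> mD Dx Dy xmin yx.
have nyx : real_norm y = real_norm x by rewrite /real_norm yx.
have := @midconvex_dist D (real_norm x) 0 y x mD (real_norm_ge0 x).
rewrite lexx ler01 addr0 nyx mulr0 => /(_ isT) h.
have : real_norm (y - x) ^+ 2 <= 0.
  by apply: h => // z /xmin; rewrite ler_real_norm.
move=> h0; have /eqP : real_norm (y - x) ^+ 2 == 0.
  by rewrite eq_le h0 sqr_ge0.
move/eqP; rewrite sqrf_eq0 => /eqP yx0.
by apply/eqP; rewrite -subr_eq0 -normr_eq0 -real_normE yx0.
Qed.

(** The sets of vectors of [D] whose norm exceeds the infimum by at most [d]
generate a Cauchy filter, by uniform convexity. *)
Lemma min_norm_exists (D : set K) : closed D -> midconvex D -> D !=set0 ->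
  exists2 x, D x & forall z, D z -> `|x| <= `|z|.
Proof.
move=> cD mD [z0 Dz0].
pose E := real_norm @` D; pose m := inf E.
have E0 : E !=set0 by exists (real_norm z0), z0.
have lbE : lbound E 0 by move=> _ [z _ <-]; exact: real_norm_ge0.
have m0 : 0 <= m by exact: lb_le_inf.
have Dm z : D z -> m <= real_norm z.
  by move=> Dz; apply: ge_inf; [exists 0 | exists z].
pose B d := [set z | D z /\ real_norm z <= m + d].
pose F := filter_from [set d : R | 0 < d] B.
have FF : ProperFilter F.
  apply: filter_from_proper; last first.
    move=> d d0; have iE : has_inf E by split => //; exists 0.
    have [_ [z Dz <-] zm] := inf_adherent d0 iE.
    by exists z; split => //; exact: ltW.
  apply: filter_from_filter; first by exists 1; exact: ltr01.
  move=> c d c0 d0; exists (Num.min c d); first by rewrite /= lt_min c0.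
  move=> z [Dz zm]; split; split => //; apply: (le_trans zm);
    by rewrite lerD2l ge_min lexx ?orbT.
have FB d : 0 < d -> F (B d) by move=> d0; exists d.
have /cvg_ex[x Fx] : cvg F.
  apply: cauchy_cvg; apply/(cauchyP (R := R[i])) => e e0.
  have eE : (complex.Re e)%:C%C = e by rewrite RRe_real// gtr0_real.
  move: e0; rewrite -eE ltcR; move: (complex.Re e) => {eE} {}e e0.
  (* With d <= 1 the bound (8 m + 4) d is below e ^ 2. *)
  pose d := Num.min 1 (e ^+ 2 / (8 * m + 5)).
  have d0 : 0 < d by rewrite lt_min ltr01/= divr_gt0 ?exprn_gt0//; lra.
  have [y [Dy ym]] := filter_ex (FB d d0).
  exists y; apply: filterS (FB d d0) => z [Dz zm].
  rewrite -ball_normE /ball_/= -real_normE ltcR.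
  rewrite -(@ltr_pXn2r _ 2) ?nnegrE ?real_norm_ge0 ?(ltW e0)//.
  have d1 : 0 <= d <= 1 by rewrite (ltW d0) ge_min lexx.
  apply: le_lt_trans (midconvex_dist mD m0 d1 Dm Dy Dz ym zm) _.
  have : d * (8 * m + 5) <= e ^+ 2.
    by rewrite -ler_pdivlMr ?ge_min ?lexx ?orbT//; lra.
  nra.
have Dx : D x.
  refine (@closed_cvg K K F FF id D cD _ x Fx).
  by apply: filterS (FB 1 ltr01) => z [].
exists x => // z Dz; rewrite -ler_real_norm; apply: le_trans (Dm _ Dz).
apply/ler_addgt0Pr => e e0.
have e20 : 0 < e / 2 by rewrite divr_gt0.
have : nbhs x (ball x (e / 2)%:C%C) by apply: nbhsx_ballx; rewrite ltcR.
move=> /Fx Fb; have [y [xy [_ ym]]] := filter_ex (filterI Fb (FB _ e20)).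
move: xy; rewrite -ball_normE /ball_/= => xy.
rewrite -lecR real_normE -(subrK y x); apply: (le_trans (ler_normD _ _)).
rewrite -(real_normE y); apply: (le_trans (lerD (ltW xy) (lexx _))).
rewrite -rmorphD lecR; lra.
Qed.

Lemma closed_ball_le (x : K) (r : R) : closed [set y | real_norm (y - x) <= r].
Proof.
move=> y cly; rewrite /=; apply/ler_addgt0Pr => e e0.
have [z [zr]] : [set z | real_norm (z - x) <= r] `&` ball y e%:C%C !=set0.
  by apply: cly; apply: nbhsx_ballx; rewrite ltcR.
rewrite -ball_normE /ball_/= => yz.
rewrite -lecR real_normE -(subrK z y) -addrA; apply: (le_trans (ler_normD _ _)).
rewrite rmorphD/= [leRHS]addrC; apply: lerD; first exact: ltW.
by rewrite -real_normE lecR.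
Qed.

Lemma dist_lt_eq (x y : K) : (forall e : R[i], 0 < e -> `|x - y| < e) -> x = y.
Proof.
move=> xy; apply/eqP; apply: contraT => nxy.
by have := xy `|x - y|; rewrite normr_gt0 subr_eq0 ltxx => /(_ nxy).
Qed.

End Hilbert.

(** * Topological groups *)

Lemma mul_morph1 (G G' : groupType) (f : G -> G') :
  {morph f : x y / (x * y)%g} -> f 1%g = 1%g.
Proof. by move=> fM; apply: (mulgI (f 1%g)); rewrite -fM !mulg1. Qed.

Lemma mul_morphV (G G' : groupType) (f : G -> G') :
  {morph f : x y / (x * y)%g} -> {morph f : x / x^-1%g}.
Proof.
by move=> fM x; apply: (mulgI (f x)); rewrite -fM !mulgV (mul_morph1 fM).
Qed.

Section TopologicalGroup.
Context {G : topologicalGroupType}.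
Implicit Types (x y : G) (U V : set G).
Local Open Scope group_scope.

Lemma mulgl_continuous x : continuous (fun y : G => x * y).
Proof.
move=> y U /(@mulg_continuous G (x, y))[[A B] /= [Ax By] ABU].
apply: filterS By => z Bz; apply: (ABU (x, z)).
by split => //; exact: nbhs_singleton.
Qed.

Lemma mulgr_continuous x : continuous (fun y : G => y * x).
Proof.
move=> y U /(@mulg_continuous G (y, x))[[A B] /= [Ay Bx] ABU].
apply: filterS Ay => z Az; apply: (ABU (z, x)).
by split => //; exact: nbhs_singleton.
Qed.

Lemma nbhs_mulgl x U : nbhs (1 : G) U -> nbhs x [set y | U (x^-1 * y)].
Proof. by move=> U1; apply: (mulgl_continuous (x := x^-1)); rewrite mulVg. Qed.

Lemma nbhs_mulgVl x U : nbhs (1 : G) U -> nbhs x [set y | U (y^-1 * x)].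
Proof.
move=> U1.
have : nbhs (x^-1) [set y | U (y * x)].
  by apply: (mulgr_continuous (x := x)); rewrite mulVg.
by move=> /invg_continuous.
Qed.

Lemma nbhs1_mul U : nbhs (1 : G) U ->
  exists2 V, nbhs (1 : G) V & forall x y, V x -> V y -> U (x * y).
Proof.
rewrite -{1}(mulg1 1) => /(@mulg_continuous G (1, 1))[[A B] /= [A1 B1] ABU].
exists (A `&` B); first exact: filterI.
by move=> x y [Ax _] [_ By]; exact: (ABU (x, y)).
Qed.

Lemma nbhs1_inv U : nbhs (1 : G) U ->
  exists V, [/\ nbhs (1 : G) V, V `<=` U & forall x, V x -> V x^-1].
Proof.
move=> U1; have : nbhs (1 : G) [set y | U y^-1].
  by apply: (@invg_continuous G 1); rewrite invg1.
move=> UV1; exists (U `&` [set y | U y^-1]); split; first exact: filterI.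
  by move=> x [].
by move=> x []; split => //=; rewrite invgK.
Qed.

Lemma nbhs1_symmetric U : nbhs (1 : G) U -> exists V, [/\ nbhs (1 : G) V,
  forall x, V x -> V x^-1 & forall x y, V x -> V y -> U (x * y)].
Proof.
move=> /nbhs1_mul[W W1 WU]; have [V [V1 VW Vi]] := nbhs1_inv W1.
by exists V; split => // x y /VW Wx /VW; exact: WU.
Qed.

(** The coset space of an open subgroup is discrete. *)
Lemma open_subgroup_compact_finite (H : subgroup G) (Q : set (lcosets H)) :
  nbhs (1 : G) H -> compact Q -> finite_set Q.
Proof.
move=> H1 /compact_near_coveringP cQ.
(* Near covering is applied to the filter of sets that contain a large enough
   finite set, with the relation of membership. *)
pose F := filter_from finite_set
  (fun A : set (lcosets H) => [set B | A `<=` B]).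
have FF : Filter F.
  apply: filter_from_filter; first by exists set0.
  move=> A B fA fB; exists (A `|` B); first by rewrite finite_setU.
  by move=> C ABC; split; apply: subset_trans ABC;
    [exact: subsetUl|exact: subsetUr].
have open1 (q : lcosets H) : open [set q].
  rewrite /open/= /quotient_open openE => x /= qx.
  apply: filterS (nbhs_mulgl x H1) => y /= Hxy.
  by rewrite -qx; apply/esym/to_lcosetE.
have [] := cQ _ F (fun A => A) FF.
  move=> q Qq; exists ([set q], [set B | B q]); last by move=> [a B] /= [-> ].
  split; first by apply: open_nbhs_nbhs; split => //; exact: open1.
  by exists [set q] => // B /= /(_ q); exact.
by move=> A fA QA; apply: sub_finite_set fA; exact: QA.
Qed.
End TopologicalGroup.

(** * Vectors fixed by a subgroup *)

Section Rep.
Context {R : realType} {G : topologicalGroupType} {K : hilbertType R}.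
Variable pi : unitary_rep G K.

Lemma rep_norm g x : `|pi g x| = `|x|.
Proof. by apply: (isometry_norm (f := pi g)) => y z; exact: rep_inner. Qed.

Lemma rep_distM g h x : `|pi (g * h)%g x - pi g x| = `|pi h x - x|.
Proof. by rewrite repM -linearB rep_norm. Qed.

Lemma rep_dist g h x : `|pi h x - pi g x| = `|pi (g^-1 * h)%g x - x|.
Proof. by rewrite -(rep_distM g) mulgA mulgV mul1g. Qed.

(** The vector of least norm in the smallest closed midpoint convex set that
contains the [H]-orbit of [x]: this set is [H]-stable and lies in the closed
ball of radius [e] around [x], and [H] acts by isometries, so that uniqueness
makes the vector [H]-invariant. *)
Lemma fixed_vector_near (H : subgroup G) x (e : R) :
  (forall g, H g -> real_norm (pi g x - x) <= e) ->
  exists2 y, invariant pi H y & real_norm (y - x) <= e.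
Proof.
move=> He.
pose admissible (D : set K) := [/\ closed D, midconvex D &
  forall g, H g -> D (pi g x)].
pose C := \bigcap_(D in admissible) D.
have cC : closed C by apply: closed_bigI => D [].
have mC : midconvex C.
  move=> y z Cy Cz D aD; have [_ mD _] := aD.
  by apply: mD; [exact: Cy|exact: Cz].
have C0 : C !=set0.
  by exists x => D [_ _]; rewrite -{2}[x](rep1 pi); apply; exact: subgroup1.
have piC h y : H h -> C y -> C (pi h y).
  move=> Hh Cy D [cD mD DH]; apply: (Cy (pi h @^-1` D)); split.
  - have /continuous_closedP := isometry_continuous (f := pi h) (rep_norm h).
    by apply.
  - by move=> a b /= Da Db; rewrite linearZ linearD; exact: mD.
  - by move=> g Hg /=; rewrite -repM; apply: DH; exact: subgroupM.
have [y Cy ymin] := min_norm_exists cC mC C0.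
exists y.
  move=> h Hh; apply: (min_norm_unique mC Cy (piC _ _ Hh Cy)) => //.
  exact: rep_norm.
apply: (Cy [set z | real_norm (z - x) <= e]); split => //.
  exact: closed_ball_le.
move=> a b /= ae be.
have -> : 2^-1 *: (a + b) - x = 2^-1 *: ((a - x) + (b - x)).
  rewrite addrACA -opprD scalerBr; congr (_ - _).
  rewrite -mulr2n -scalerMnr scalerMnl -mulr_natr mulVf ?pnatr_eq0// scale1r//.
rewrite real_norm_mid ler_pdivrMr// mulr_natr mulr2n.
apply: le_trans (lerD ae be).
by rewrite -lecR rmorphD/= !real_normE; exact: ler_normD.
Qed.
End Rep.

(** * Almost invariant vectors *)

Lemma to_lcoset_continuous (G : topologicalGroupType) (H : subgroup G) :
  continuous (to_lcoset H : G -> lcosets H).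
Proof. exact: pi_continuous. Qed.

(** A homomorphism [f] that maps [H] into [H'] induces a continuous map between
the coset spaces, which carries compact sets of cosets to compact sets. *)
Section MapCosets.
Context {G G' : topologicalGroupType} (H : subgroup G) (H' : subgroup G').
Variable f : G -> G'.
Hypothesis fM : {morph f : x y / (x * y)%g}.
Hypothesis fH : f @` H `<=` H'.

Definition map_lcosets (q : lcosets H) : lcosets H' :=
  to_lcoset H' (f (repr q)).

Lemma map_lcosetsE g : map_lcosets (to_lcoset H g) = to_lcoset H' (f g).
Proof.
rewrite /map_lcosets; apply/to_lcosetE.
rewrite -(mul_morphV fM) -fM; apply: fH; eexists; last by [].
by apply/to_lcosetE; exact: reprK.
Qed.

Lemma map_lcosets_continuous : continuous f -> continuous map_lcosets.
Proof.
move=> fc; apply/quotient_continuous.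
rewrite (_ : _ \o _ = to_lcoset H' \o f).
  by move=> x; apply: continuous_comp; [exact: fc|exact: to_lcoset_continuous].
by apply/funext => g /=; exact: map_lcosetsE.
Qed.

End MapCosets.

Section AlmostInvariant.
Context {R : realType} {G : topologicalGroupType} {K : hilbertType R}.
Variable pi : unitary_rep G K.

(** For an open subgroup, compact sets of cosets are finite, so that almost
invariance may be tested on finite sets of group elements. *)
Lemma almost_invariant_open (H : subgroup G) : nbhs (1 : G)%g H ->
  (forall (S : set G) (eps : R), finite_set S -> 0 < eps -> exists x,
    [/\ `|x| = 1, invariant pi H x & forall g, S g -> `|pi g x - x| < eps%:C%C])
  -> has_almost_invariant pi H.
Proof.
move=> H1 finH Q eps cQ e0.
have fQ := open_subgroup_compact_finite H1 cQ.
have [x [x1 xH xS]] := finH (repr @` Q) eps (finite_image _ fQ) e0.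
exists x; split => // g Qg.
have Hg : H ((repr (to_lcoset H g))^-1 * g)%g by apply/to_lcosetE; exact: reprK.
rewrite -(mul1g g) -(mulgV (repr (to_lcoset H g))) -mulgA repM (xH _ Hg).
by apply: xS; exists (to_lcoset H g).
Qed.

Lemma almost_invariant_finite (H : subgroup G) (S : set G) (eps : R) :
  has_almost_invariant pi H -> finite_set S -> 0 < eps -> exists x,
    [/\ `|x| = 1, invariant pi H x & forall g, S g -> `|pi g x - x| < eps%:C%C].
Proof.
move=> aiH fS e0.
have cS : compact (to_lcoset H @` S).
  by apply: finite_compact; exact: finite_image.
have [x [x1 xH xS]] := aiH _ eps cS e0.
by exists x; split => // g Sg; apply: xS; exists g.
Qed.

Lemma closed_fixer (x : K) : closed [set g | pi g x = x].
Proof.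
have /continuous_closedP/(_ [set x]) := @rep_continuous _ _ _ pi x; apply.
exact/accessible_closed_set1/hausdorff_accessible/norm_hausdorff.
Qed.

Lemma invariant_closure (A : set G) (x : K) :
  invariant pi A x -> invariant pi (closure A) x.
Proof.
move=> Ax g cg.
by apply: (@closed_fixer x); apply: closure_subset cg; exact: Ax.
Qed.

Lemma almost_invariant_sub (H H' : subgroup G) : H `<=` H' ->
  has_almost_invariant pi H' -> has_almost_invariant pi H.
Proof.
move=> HH' aiH' Q eps cQ e0.
have idH : (fun x : G => x) @` H `<=` H' by move=> _ [x Hx <-]; exact: HH'.
have idM : {morph (fun x : G => x) : x y / (x * y)%g} by [].
have cf : continuous (map_lcosets H' (fun x : G => x) : lcosets H -> _).
  by apply: map_lcosets_continuous => // x; exact: cvg_id.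
have cQ' := continuous_compact (continuous_subspaceT cf) cQ.
have [x [x1 xH' xQ]] := aiH' _ eps cQ' e0.
exists x; split => // [g /HH' /xH'//|g Qg]; apply: xQ.
by exists (to_lcoset H g) => //; rewrite (map_lcosetsE idM idH).
Qed.

End AlmostInvariant.

(** * Transfer of property (T) *)

Section Pullback.
Context {R : realType} {G G' : topologicalGroupType} {K : hilbertType R}.
Variables (pi : unitary_rep G' K) (f : G -> G').
Hypothesis fM : {morph f : x y / (x * y)%g}.
Hypothesis fc : continuous f.

Definition pullback_rep : unitary_rep G K.
Proof.
refine (@UnitaryRep R G K (fun g => pi (f g)) _ _ _ _).
- by move=> x; rewrite (mul_morph1 fM) rep1.
- by move=> g h x; rewrite fM repM.
- by move=> g x y; exact: rep_inner.
- move=> x g; apply: (@continuous_comp _ _ _ f (fun g => pi g x)).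
    exact: fc.
  exact: rep_continuous.
Defined.

End Pullback.

(** A pulled back representation keeps its almost invariant vectors, and a
vector fixed by a dense subgroup is fixed by continuity. *)
Lemma property_T_dense_image (R : realType) (G G' : topologicalGroupType)
    (H : subgroup G) (H' : subgroup G') (f : G -> G') :
  {morph f : x y / (x * y)%g} -> continuous f -> dense (range f) ->
  f @` H `<=` H' -> property_T R H -> property_T R H'.
Proof.
move=> fM fc fd fH TH K pi aiH'.
have [|x x0 xinv] := TH K (pullback_rep pi fM fc).
  move=> Q eps cQ e0.
  have cf := map_lcosets_continuous fM fH fc.
  have cQ' := continuous_compact (continuous_subspaceT cf) cQ.
  have [x [x1 xH' xQ]] := aiH' _ eps cQ' e0.
  exists x; split => // [g Hg|g Qg] /=.
    by apply: xH'; apply: fH; exists g.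
  by apply: xQ; exists (to_lcoset H g) => //; rewrite (map_lcosetsE fM fH).
exists x => // g _; apply: (@invariant_closure _ _ _ pi (range f)).
  by move=> _ [h _ <-]; exact: xinv.
move=> U; rewrite nbhsE => -[V [oV Vg] VU].
have [h [Vh fh]] := fd V (ex_intro _ g Vg) oV.
by exists h; split => //; exact: VU.
Qed.

(** An almost invariant vector [x] is moved little by the compact group [H], so
it lies near an [H]-invariant vector [y], which is moved little as well. *)
Lemma property_T_compact_open (R : realType) (G : topologicalGroupType)
    (H : subgroup G) : nbhs (1 : G)%g H -> compact H ->
  property_T R H -> group_property_T R G.
Proof.
move=> H1 cH TH K pi aiG; apply: (TH K pi).
apply: almost_invariant_open => // S eps fS e0.
(* If x is moved by less than d, then y has norm at least 1 - d >= 1/2 and is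
   moved by less than 3 d, so that its normalization is moved by less than
   6 d <= eps / 2. *)
pose d : R := Num.min 2^-1 (eps / 12).
have d0 : 0 < d by rewrite lt_min invr_gt0 ltr0n divr_gt0.
have d2 : d <= 2^-1 by rewrite ge_min lexx.
have d12 : d * 12 <= eps by rewrite -ler_pdivlMr// ge_min lexx orbT.
have cQ : compact (to_lcoset (@trivial_subgroup G) @` (H `|` S)).
  apply: continuous_compact.
    by apply: continuous_subspaceT; exact: to_lcoset_continuous.
  by apply: compactU => //; exact: finite_compact.
have [x [x1 _ xQ]] := aiG _ d cQ d0.
have {}xQ g : (H `|` S) g -> real_norm (pi g x - x) < d.
  by move=> HSg; rewrite -ltcR real_normE; apply: xQ; exists g.
have [|y yH yx] := @fixed_vector_near R G K pi H x d.
  by move=> g Hg; apply/ltW/xQ; left.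
have y2 : 2^-1 <= real_norm y.
  have := ler_real_distD y x 0; rewrite !subr0 real_distC.
  have -> : real_norm x = 1 by rewrite /real_norm x1.
  lra.
have y0 : 0 < real_norm y by apply: lt_le_trans y2; rewrite invr_gt0.
exists (((real_norm y)^-1)%:C%C *: y); split.
- rewrite normrZ -real_normE ger0_norm ?lecR ?invr_ge0 ?(ltW y0)//.
  by rewrite -rmorphM/= mulVf// gt_eqF.
- by move=> g Hg; rewrite linearZ yH.
move=> g Sg; rewrite linearZ -scalerBr normrZ -real_normE.
rewrite ger0_norm ?lecR ?invr_ge0 ?(ltW y0)// -rmorphM/= ltcR.
rewrite mulrC ltr_pdivrMr//.
have pyx : real_norm (pi g y - pi g x) = real_norm (y - x).
  by rewrite -linearB /real_norm rep_norm.
have := ler_real_distD (pi g x) (pi g y) y; rewrite pyx.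
have := ler_real_distD x (pi g x) y; rewrite (real_distC x y).
have := xQ g (or_intror Sg).
nra.
Qed.

(** * Extending a representation along a dense homomorphism *)

(** The representation [pi] of [G] is extended to [G'] as far as its continuity
for the topology induced by [j] allows. *)
Section Extension.
Context {R : realType} {G G' : topologicalGroupType} {K : hilbertType R}.
Variables (pi : unitary_rep G K) (j : G -> G').
Hypothesis jM : {morph j : x y / (x * y)%g}.
Hypothesis jd : dense (range j).
Implicit Types (g h : G) (y z : G') (x : K).

(** The trace on [G] of the neighbourhoods of [y]; limits along it are limits as
[j g] tends to [y]. *)
Definition nearby y : set_system G :=
  [set A | exists2 U, nbhs y U & j @^-1` U `<=` A].

Lemma nearby_preimage y U : nbhs y U -> nearby y (j @^-1` U).
Proof. by exists U. Qed.

Lemma nearby_filter y : ProperFilter (nearby y).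
Proof.
apply: Build_ProperFilter_ex.
  move=> A [U]; rewrite nbhsE => -[V [oV Vy] VU] UA.
  have [z [Vz [g _ gE]]] := jd (ex_intro _ y Vy) oV.
  by exists g; apply/UA/VU; rewrite gE.
split; first by exists setT => //; exact: filterT.
- move=> A B [U Uy UA] [V Vy VB]; exists (U `&` V); first exact: filterI.
  by move=> g [/UA ? /VB].
- by move=> A B AB [U Uy UA]; exists U => //; exact: subset_trans AB.
Qed.
Local Existing Instance nearby_filter.

Let jV g : j g^-1%g = (j g)^-1%g.
Proof. exact: mul_morphV. Qed.

(** Vectors whose orbit map is continuous at 1 for the topology induced by
[j]. *)
Definition extendable : set K := [set x | pi g x @[g --> nearby 1%g] --> x].

(** Since [pi] is isometric, continuity of the orbit map at 1 is uniform, which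
makes the orbit map Cauchy near every point of [G']. *)
Lemma extendable_equicontinuous x y (e : R[i]) : extendable x -> 0 < e ->
  exists2 W, nbhs y W &
    forall g h, W (j g) -> W (j h) -> `|pi h x - pi g x| < e.
Proof.
move=> /cvgrPdist_lt xE e0; have [U U1 Ux] := xE e e0.
have [V [V1 VV VU]] := nbhs1_symmetric U1.
exists [set z | V (y^-1 * z)%g]; first exact: nbhs_mulgl.
move=> g h /= Vg Vh; rewrite rep_dist distrC; apply: Ux => /=.
rewrite jM jV (_ : _ * _ = (y^-1 * j g)^-1 * (y^-1 * j h))%g.
  by apply: VU => //; exact: VV.
by rewrite invgM invgK -mulgA (mulgA y) mulgV mul1g.
Qed.

Fact extendable_submod : submod_closed [in extendable].
Proof.
split.
  apply/mem_set; apply/cvgrPdist_lt => e e0; near=> g.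
  by rewrite linear0 subrr normr0.
move=> a x w /set_mem xE /set_mem wE; apply/mem_set; rewrite /extendable/=.
under eq_cvg do rewrite linearP.
by apply: cvgD => //; apply: cvgZl_tmp.
Unshelve. all: by end_near. Qed.

Fact extendable_closed : closed extendable.
Proof.
move=> x clx; apply/cvgrPdist_lt => e e0.
have e30 : 0 < e / 3%:R by rewrite divr_gt0.
have [w [wE]] := clx _ (nbhsx_ballx x _ e30).
rewrite -ball_normE /ball_/= => xw.
move/cvgrPdist_lt : wE => /(_ _ e30); apply: filterS => g wg.
rewrite (_ : x - pi g x = (x - w) + (w - pi g w) + pi g (w - x)); last first.
  by rewrite linearB !addrA !subrK.
rewrite (_ : e = e / 3%:R + e / 3%:R + e / 3%:R); last by field.
apply: (le_lt_trans (ler_normD _ _)); apply: ltrD; last first.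
  by rewrite rep_norm distrC.
by apply: (le_lt_trans (ler_normD _ _)); apply: ltrD.
Qed.

Definition extendable_space : closed_subspace :=
  ClosedSubspace extendable_submod extendable_closed.

(** Invariance comes from continuity of conjugation by [j g] in [G']. *)
Lemma extendable_rep g x : extendable x -> extendable (pi g x).
Proof.
move=> /cvgrPdist_lt xE; apply/cvgrPdist_lt => e e0; have [U U1 Ux] := xE e e0.
exists [set z | U ((j g)^-1 * z * j g)%g].
  have U1' : nbhs ((j g)^-1 * 1 * j g)%g U by rewrite mulg1 mulVg.
  exact: (mulgl_continuous (mulgr_continuous U1')).
move=> h Uh; rewrite -repM distrC rep_dist distrC; apply: Ux.
by rewrite /= !jM jV mulgA.
Qed.

Definition extended_rep y x : K := lim (pi g x @[g --> nearby y]).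

Lemma extended_rep_cvg y x : extendable x ->
  pi g x @[g --> nearby y] --> extended_rep y x.
Proof.
move=> xE; apply: cauchy_cvg; apply/(cauchyP (R := R[i])) => e e0.
have [W Wy We] := extendable_equicontinuous y xE e0.
have [g Wg] := filter_ex (nearby_preimage Wy).
exists (pi g x); exists W => // h Wh /=.
by rewrite -ball_normE /ball_/= distrC; exact: We.
Qed.


Lemma extended_rep_eq y x (w : K) : pi g x @[g --> nearby y] --> w ->
  extended_rep y x = w.
Proof. by apply: cvg_lim; exact: norm_hausdorff. Qed.

Lemma extended_rep_extendable y x :
  extendable x -> extendable (extended_rep y x).
Proof.
move=> xE; refine (@closed_cvg G K (nearby y) _ (fun g => pi g x) extendable
  extendable_closed _ _ (@extended_rep_cvg y _ xE)).
by apply: nearW => g; exact: extendable_rep.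
Qed.

Lemma extended_rep1 x : extendable x -> extended_rep 1%g x = x.
Proof. exact: extended_rep_eq. Qed.

Lemma extended_repE g x : extendable x -> extended_rep (j g) x = pi g x.
Proof.
move=> xE; apply: extended_rep_eq; apply/cvgrPdist_lt => e e0.
have [W Wg We] := extendable_equicontinuous (j g) xE e0.
by exists W => // h Wh; apply: We => //; exact: nbhs_singleton.
Qed.

(** Both sides are compared with [pi (g * h) x], for [g] and [h] in [G] such
that [j g] is close to [y] and [j h] is close to [z]. *)
Lemma extended_repM y z x : extendable x ->
  extended_rep (y * z)%g x = extended_rep y (extended_rep z x).
Proof.
move=> xE; apply: dist_lt_eq => e e0.
have e30 : 0 < e / 3%:R by rewrite divr_gt0.
set w := extended_rep z x.
have wE : extendable w by exact: extended_rep_extendable.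
have /cvgrPdist_lt/(_ _ e30)[U Uyz Ue] := @extended_rep_cvg (y * z)%g _ xE.
have [[A B] /= [Ay Bz] ABU] := @mulg_continuous G' (y, z) U Uyz.
have /cvgrPdist_lt/(_ _ e30) ye := @extended_rep_cvg y _ wE.
have /cvgrPdist_lt/(_ _ e30) ze := @extended_rep_cvg z _ xE.
have [g [Ag ge]] := filter_ex (filterI (nearby_preimage Ay) ye).
have [h [Bh he]] := filter_ex (filterI (nearby_preimage Bz) ze).
have {}Ue := Ue (g * h)%g; rewrite /= jM in Ue.
have {}Ue := Ue (ABU (j g, j h) (conj Ag Bh)).
rewrite -(subrK (pi (g * h)%g x) (extended_rep (y * z)%g x)) -addrA.
rewrite (_ : e = e / 3%:R + (e / 3%:R + e / 3%:R)); last by field.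
apply: (le_lt_trans (ler_normD _ _)); apply: ltrD => //.
rewrite -(subrK (pi g w) (pi (g * h)%g x)) -addrA.
apply: (le_lt_trans (ler_normD _ _)); apply: ltrD; last by rewrite distrC.
by rewrite repM -linearB rep_norm distrC.
Qed.

Lemma extended_rep_norm y x : extendable x -> `|extended_rep y x| = `|x|.
Proof.
move=> xE; have := cvg_norm (@extended_rep_cvg y _ xE).
under eq_cvg do rewrite rep_norm.
have FF := nearby_filter y.
by move=> /(_ _) h; apply: cvg_unique h (cvg_cst _); exact: norm_hausdorff.
Qed.

Lemma extended_rep_linear y (a : R[i]) x (w : K) :
  extendable x -> extendable w ->
  extended_rep y (a *: x + w) = a *: extended_rep y x + extended_rep y w.
Proof.
move=> xE wE; apply: extended_rep_eq.
under eq_cvg do rewrite linearP.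
by apply: cvgD; [apply: cvgZl_tmp|]; exact: extended_rep_cvg.
Qed.

(** For [z] close to [y], the values at [y] and [z] are approximated by [pi g x]
and [pi h x], with [j g] and [j h] in one small neighbourhood of [y]. *)
Lemma extended_rep_continuous x : extendable x ->
  continuous (fun y => extended_rep y x).
Proof.
move=> xE y; apply/cvgrPdist_lt => e e0.
have e30 : 0 < e / 3%:R by rewrite divr_gt0.
have [W Wy We] := extendable_equicontinuous y xE e30.
have /cvgrPdist_lt/(_ _ e30) ye := @extended_rep_cvg y _ xE.
have [g [Wg ge]] := filter_ex (filterI (nearby_preimage Wy) ye).

apply: filterS (nbhs_interior Wy) => z Wz.
have /cvgrPdist_lt/(_ _ e30) ze := @extended_rep_cvg z _ xE.
have [h [Wh he]] := filter_ex (filterI (nearby_preimage Wz) ze).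
rewrite -(subrK (pi g x) (extended_rep y x)) -addrA.
rewrite (_ : e = e / 3%:R + (e / 3%:R + e / 3%:R)); last by field.
apply: (le_lt_trans (ler_normD _ _)); apply: ltrD => //.
rewrite -(subrK (pi h x) (pi g x)) -addrA.
apply: (le_lt_trans (ler_normD _ _)); apply: ltrD; last by rewrite distrC.
exact: We.
Qed.

Local Notation E := (subspace_type extendable_space).

Definition extended_op y (x : E) : E :=
  Sub (extended_rep y (val x))
    (mem_set (@extended_rep_extendable y _ (set_mem (valP x)))).

Fact extended_op_linear y : linear (extended_op y).
Proof.
move=> a x w; apply: val_inj; rewrite linearP/=.
by rewrite -extended_rep_linear ?linearP//; exact/set_mem/valP.
Qed.

HB.instance Definition _ y :=
  GRing.isLinear.Build R[i] E E _ (extended_op y) (extended_op_linear y).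

Definition extension : unitary_rep G' E.
Proof.
refine (@UnitaryRep R G' E (fun y => extended_op y : {linear E -> E}) _ _ _ _).
- move=> x; apply: val_inj; exact/extended_rep1/set_mem/valP.
- move=> y z x; apply: val_inj; exact/extended_repM/set_mem/valP.
- move=> y x w; apply: (isometry_inner (f := extended_op y)) => v.
  exact/extended_rep_norm/set_mem/valP.
- move=> x y; apply/cvgrPdist_lt => e e0.
  have xE : extendable (val x) by exact/set_mem/valP.
  have /cvgrPdist_lt/(_ _ e0) := @extended_rep_continuous _ xE y.
  by apply: filterS => z; rewrite subspace_normE raddfB.
Defined.

End Extension.

(** The representation of [G] is extended to [G'] on the subspace of extendable
vectors, which contains the [H]-invariant ones because [H] is open for the
topology induced by [j]. *)
Lemma property_T_completion (R : realType) (G G' : topologicalGroupType)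
    (H : subgroup G) (H' : subgroup G') (j : G -> G') :
  {morph j : x y / (x * y)%g} -> dense (range j) ->
  nbhs (1 : G')%g H' -> H' `<=` closure (j @` H) ->
  (exists2 U, nbhs (1 : G')%g U & j @^-1` U `<=` H) ->
  property_T R H' -> property_T R H.
Proof.
move=> jM jd H'1 H'j [U U1 UH] TH' K pi aiH.
pose V := extendable_space pi jd.
pose rho := extension pi jM jd.
have Hext (x : K) : invariant pi H x -> extendable pi j x.
  have FF := nearby_filter jd 1%g.
  move=> xH; apply/cvgrPdist_lt => e e0; exists U => // g /UH Hg /=.
  by rewrite xH// subrr normr0.
have rhoE g (x : subspace_type V) : val (rho (j g) x) = pi g (val x).
  exact/extended_repE/set_mem/valP.
have [|x x0 xinv] := TH' (subspace_type V) rho.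
  apply: almost_invariant_open => // S eps fS e0.
  (* Every coset of the open subgroup H' contains a point of the dense range. *)
  have dS s : exists g, H' (s^-1 * j g)%g.
    have := nbhs_mulgl s H'1; rewrite nbhsE => -[W [oW Ws] WH'].
    have [z [Wz [g _ gE]]] := jd W (ex_intro _ s Ws) oW.
    by exists g; apply: WH'; rewrite gE.
  have [d dP] := choice dS.
  have [x [x1 xH xS]] := almost_invariant_finite aiH (finite_image d fS) e0.
  pose v : subspace_type V := Sub x (mem_set (Hext x xH)).
  have vH' : invariant rho H' v.
    move=> h /H'j; apply: invariant_closure => _ [g Hg <-].
    by apply: val_inj; rewrite rhoE; exact: (xH _ Hg).
  exists v; split => // s Ss.
  have -> : rho s v = rho (j (d s)) v.
    by rewrite -(mul1g (j (d s))) -(mulgV s) -mulgA repM (vH' _ (dP s)).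
  have -> : `|rho (j (d s)) v - v| = `|val (rho (j (d s)) v) - x|.
    by rewrite subspace_normE raddfB.
  by rewrite rhoE; apply: xS; exact: imageP.
exists (val x).
  by apply: contra x0 => /eqP x0; apply/eqP/val_inj; rewrite x0 raddf0.
by move=> g _; rewrite -rhoE xinv.
Qed.

(** * Compactness of the closed Hecke subgroup *)

Lemma closure_dense_nbhs (G : Type) (G' : topologicalType) (j : G -> G')
    (A : set G) (y : G') (U : set G') :
  dense (range j) -> nbhs y U -> j @^-1` U `<=` A -> nbhs y (closure (j @` A)).
Proof.
move=> jd; rewrite nbhsE => -[O [oO Oy] OU] UA.
exists O => // z Oz N; rewrite nbhsE => -[P [oP Pz] PN].
have OP : O `&` P !=set0 by exists z.
have [w [[Ow Pw] [g _ gw]]] := jd _ OP (openI oO oP).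
exists w; split; last exact: PN.
by exists g => //; apply: UA; rewrite /= gw; exact: OU.
Qed.

Lemma ultra_bigcup (T : Type) (I : choiceType) (F : set_system T) (S : set I)
    (A : set T) (B : I -> set T) : UltraFilter F -> finite_set S -> F A ->
  A `<=` \bigcup_(s in S) B s -> exists2 s, S s & F (B s).
Proof.
move=> FU /finite_fsetP[X ->] FA AB; apply: contrapT => nB.
have FC s : [set` X] s -> F (~` B s).
  move=> sX; have [FB|//] := in_ultra_setVsetC (B s) FU.
  by case: nB; exists s.
have FI := @filter_bigI _ _ X (fun s => ~` B s) F (@ultra_proper _ _ FU) FC.
have [x [Ax xC]] := filter_ex (filterI FA FI).
by have [s /= sX Bs] := AB x Ax; apply: (xC s).
Qed.

(** The closure of [j @` H] is covered by finitely many left translates of a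
small neighbourhood and, as it is stable under inversion, by finitely many right
translates. An ultrafilter on it contains one of each kind, hence is Cauchy for
the two-sided uniformity. *)
Lemma totally_bounded_closure_compact (G : groupType)
    (G' : topologicalGroupType) (H : subgroup G)
    (j : UMagmaMorphism.type G G') :
  group_complete G' ->
  (forall U, nbhs (1 : G')%g U -> exists2 S : set G, finite_set S &
    forall h, H h -> exists2 s, S s & U (j (s^-1 * h)%g)) ->
  compact (closure (j @` H)).
Proof.
move=> G'c tb; rewrite compact_ultra => F FU FH.
set C := closure (j @` H) in FH *.
have CV z : C z -> C z^-1%g.
  exact: (subgroupV (H := closure_subgroup (image_subgroup j H))).
suff /G'c[x Fx] : group_cauchy F.
  exists x; split => //; apply: closed_closure => N /Fx FN.
  exact: filter_ex (filterI FH FN).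
move=> U U1.
have [V [V1 VV VU]] := nbhs1_symmetric U1.
have [W [W1 _ WV]] := nbhs1_symmetric V1.
have [S fS SW] := tb W W1.
pose B s := [set z | V ((j s)^-1 * z)%g].
have CB : C `<=` \bigcup_(s in S) B s.
  move=> z /(_ _ (nbhs_mulgVl z W1))[_ [[h Hh <-] /= Whz]].
  have [s Ss Wsh] := SW h Hh; exists s => //=.
  move: Wsh; rewrite gmulfM gmulfV => Wsh.
  by have := WV _ _ Wsh Whz; rewrite mulgA mulgK.
have [s Ss FB] := ultra_bigcup FU fS FH CB.
have CBV : C `<=` \bigcup_(s in S) [set z | B s z^-1%g].
  by move=> z /CV/CB.
have [t St FBV] := ultra_bigcup FU fS FH CBV.
exists (B s `&` [set z | B t z^-1%g]); first exact: filterI.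
move=> x y [Bx Btx] [By Bty]; split.
  have := VU _ _ (VV _ Bx) By.
  by rewrite invgM invgK -mulgA (mulgA (j s)) mulgV mul1g.
have := VU _ _ (VV _ Btx) Bty.
by rewrite invgM !invgK -mulgA (mulgA (j t)) mulgV mul1g.
Qed.

Section HeckeIndex.
Context {G : groupType} (H : subgroup G).
Local Open Scope group_scope.

Lemma lcoset_eq x y : lcoset H x = lcoset H y -> H (x^-1 * y).
Proof.
move=> xy; have : lcoset H x y.
  by rewrite xy; exists 1; rewrite ?mulg1//; exact: subgroup1.
by move=> [h Hh <-]; rewrite mulgA mulVg mul1g.
Qed.

(** [H] meets each finite intersection of its conjugates in a subgroup of finite
index: the coset of [h] is determined by the left cosets [h a H], each of which
is one of the finitely many left cosets in [H a H]. *)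
Lemma hecke_finite_index (A : set G) : hecke_pair H -> finite_set A ->
  exists2 S : set G, finite_set S & forall h, H h ->
    exists2 s, S s & forall a, A a -> lconj H a (s^-1 * h).
Proof.
move=> hp /finite_seqP[r ->{A}].
suff [S fS Sr] : exists2 S : set G, finite_set S & forall h, H h ->
    exists2 s, S s & forall a, a \in r -> lcoset H (s * a) = lcoset H (h * a).
  exists S => // h /Sr[s Ss sa]; exists s => // a /= /sa /lcoset_eq.
  by rewrite invgM !mulgA => ?; apply/lconjE; rewrite !mulgA.
(* A representative is chosen for each pair of a representative for r and a
   coset h a H that occur together. *)
elim: r => [|a r [S fS Sr]]; first by exists [set 1] => // h _; exists 1.
pose C := [set C | range (lcoset H) C /\ C `<=` dcoset H a].
pose P (p : G * set G) := [set h | H h /\ lcoset H (h * a) = p.2 /\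
  forall b, b \in r -> lcoset H (p.1 * b) = lcoset H (h * b)].
exists ((fun p => xget 1 (P p)) @` (S `*` C)).
  by apply: finite_image; apply: finite_setX => //; exact: hp.
move=> h Hh; have [s Ss sr] := Sr h Hh.
pose p := (s, lcoset H (h * a)).
have [_ [pa pr]] : P p (xget 1 (P p)) by apply: (@xgetPex _ 1 (P p)); exists h.
exists (xget 1 (P p)).
  exists p => //; split => //=; split; first by exists (h * a).
  by move=> _ [k Hk <-]; exists h => //; exists k.
move=> b; rewrite inE => /orP[/eqP ->//|br].
by rewrite -pr// sr.
Qed.

End HeckeIndex.

(** * The Schlichting completion *)

Lemma discrete_continuous (G : groupType) (T : topologicalType) (f : G -> T) :
  continuous (f : discrete_topology G -> T).
Proof.
move=> x A /nbhs_singleton Ax.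
by apply: (filterS _ (discrete_set1 x)) => _ ->.
Qed.

Section Schlichting.
Context {G : groupType} (H : subgroup G) (G' : topologicalGroupType).
Variable i : UMagmaMorphism.type (hecke_topology (reduced_subgroup H)) G'.
Hypothesis compl : schlichting_completion i.
Local Open Scope group_scope.

Definition schlichting_map (g : G) : G' := i (quotient_map (hecke_core H) g).
Local Notation q := (quotient_map (hecke_core H)).

Fact schlichting_map_morphism : monoid.monoid_morphism schlichting_map.
Proof.
split; first by rewrite /schlichting_map gmulf1.
move=> x y; rewrite /schlichting_map gmulfM; exact: gmulfM.
Qed.

HB.instance Definition _ :=
  isUMagmaMorphism.Build G G' schlichting_map schlichting_map_morphism.

Lemma quotient_map_surj (x : reduced_group H) : exists g, q g = x.
Proof. by elim/quotW: x => g; exists g. Qed.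

(** The core of [H] lies in [H], so [H] is the full preimage of its image. *)
Lemma reduced_subgroupE g :
  reduced_subgroup H (q g) <-> H g.
Proof.
split=> [[h Hh /quotient_groupE]|Hg]; last by exists g.
move=> /(_ 1 I)/lconjE; rewrite invg1 mul1g mulg1 => Hhg.
by rewrite -(mul1g g) -(mulgV h) -mulgA; exact: subgroupM.
Qed.

Lemma schlichting_map_dense : dense (range schlichting_map).
Proof.
move=> U U0 oU; have [z [Uz [x _ xz]]] := completion_dense compl U0 oU.
have [g gx] := quotient_map_surj x.
by exists z; split => //; exists g; rewrite // /schlichting_map gx.
Qed.

Lemma schlichting_subgroupE :
  schlichting_subgroup i = closure (schlichting_map @` H) :> set G'.
Proof. by rewrite /= image_comp. Qed.

Lemma schlichting_map_open :
  exists2 U, nbhs (1 : G') U & schlichting_map @^-1` U `<=` H.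
Proof.
have : nbhs (1 : hecke_topology (reduced_subgroup H))
    (reduced_subgroup H : set _).
  exists [set 1]; first exact: finite_set1.
  move=> _ [k /(_ 1 erefl)/lconjE Hk <-].
  by move: Hk; rewrite invg1 !mul1g mulg1.
move=> /(completion_topology compl)[U]; rewrite gmulf1 => U1 UH.
by exists U => // g Ug; apply/reduced_subgroupE; exact: UH.
Qed.

Lemma schlichting_map_total_bounded (hp : hecke_pair H) U : nbhs (1 : G') U ->
  exists2 S : set G, finite_set S &
    forall h, H h -> exists2 s, S s & U (schlichting_map (s^-1 * h)).
Proof.
move=> U1.
have : nbhs (1 : hecke_topology (reduced_subgroup H)) (i @^-1` U).
  by apply/(completion_topology compl); exists U; rewrite // gmulf1.
move=> [A fA AU].
have [d dP] := choice quotient_map_surj.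
have [S fS SH] := hecke_finite_index hp (finite_image d fA).
exists S => // h /SH[s Ss sA]; exists s => //.
apply: AU; exists (q (s^-1 * h)); last exact: mul1g.
move=> a Aa; apply/lconjE.
have /lconjE Hs := sA (d a) (imageP d Aa).
exists ((d a)^-1 * (s^-1 * h) * d a) => //.
transitivity ((q (d a))^-1 * q (s^-1 * h) * q (d a)); last by rewrite dP.
by rewrite -gmulfV -2!gmulfM.
Qed.

End Schlichting.

Theorem theoremA8 (R : realType) (G : groupType) (Gamma : subgroup G)
    (hecke : hecke_pair Gamma)
    (Gbar : topologicalGroupType)
    (i : UMagmaMorphism.type (hecke_topology (reduced_subgroup Gamma)) Gbar)
    (compl : schlichting_completion i) :
  [<-> property_T R (discrete_subgroup Gamma);
       property_T R (discrete_subgroup (reduced_subgroup Gamma));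
       property_T R (schlichting_subgroup i);
       group_property_T R Gbar].
Proof.
have jd := schlichting_map_dense compl.
have [U U1 UGamma] := schlichting_map_open compl.
have open_bar : nbhs (1 : Gbar)%g (schlichting_subgroup i).
  rewrite schlichting_subgroupE; exact: closure_dense_nbhs jd U1 UGamma.
tfae.
- apply: (@property_T_dense_image _ _ _ _ _ (quotient_map (hecke_core Gamma)
    : discrete_topology G -> discrete_topology (reduced_group Gamma))).
  + by move=> x y; exact: (@gmulfM G (reduced_group Gamma) _ x y).
  + exact: discrete_continuous.
  + move=> V [v Vv] _; have [g gv] := quotient_map_surj v.
    by exists v; split => //; exists g.
  + by [].
- apply: (@property_T_dense_image _ _ _ _ _
    (i : discrete_topology (reduced_group Gamma) -> Gbar)).
  + move=> x y.
    exact: (@gmulfM (hecke_topology (reduced_subgroup Gamma)) Gbar _ x y).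
  + exact: discrete_continuous.
  + exact: completion_dense compl.
  + exact: subset_closure.
- apply: property_T_compact_open => //.
  rewrite schlichting_subgroupE; apply: totally_bounded_closure_compact.
    exact: completion_complete compl.
  exact: schlichting_map_total_bounded.
- move=> TG; apply: (@property_T_completion _ (discrete_topology G) _ _
    (schlichting_subgroup i) (schlichting_map i)) => //.
  + by move=> x y; exact: (@gmulfM G Gbar _ x y).
  + by rewrite schlichting_subgroupE.
  + by exists U.
  + move=> K pi aiH; apply: TG; apply: almost_invariant_sub aiH.
    by move=> _ ->; exact: subgroup1.
Qed.
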